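(* The 6-element set $\{0,1,2,3,4,7\}$ is extreme in $\mathbb Z_{10}$.
   Context: $\mathbb Z_n$ denotes the cyclic group of order $n$. For a finite abelian group $G$ with dual group $\Gamma$ and a complex measure $\mu$ on $G$: $\|\mu\|=\sum_{x\in G}|\mu(\{x\})|$, $\widehat\mu(\gamma)=\sum_{x\in G}\overline{\gamma(x)}\,\mu(\{x\})$ for $\gamma\in\Gamma$, and $\|\widehat\mu\|_\infty=\max_\gamma|\widehat\mu(\gamma)|$. A non-zero measure $\mu$ on $G$ is extreme if $\|\widehat\mu\|_\infty=\|\mu\|/\sqrt{\#\mathrm{supp}\,\mu}$. A set $E\subset G$ is extreme if it is the support of an extreme measure on $G$. *)

(* Defs.v *)
From HB Require Import structures.
From mathcomp Require Import all_boot all_order all_algebra.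
From mathcomp Require Import complex.
From mathcomp Require Import boolp classical_sets functions cardinality reals.

Set Implicit Arguments.
Unset Strict Implicit.
Unset Printing Implicit Defensive.

Import Order.TTheory GRing.Theory Num.Theory.

Local Open Scope classical_set_scope.
Local Open Scope ring_scope.

(* [ComplexField.Normc.normc] is the modulus with values in [R]; the norm     *)
(* [`|z|] on [R[i]] takes its values in [R[i]].                               *)
Notation modulus := ComplexField.Normc.normc.

(* A complex measure on a finite group is the function x |-> mu({x}). *)
Notation cmeasure R G := {ffun G -> R[i]}.

Section FiniteAbelianGroup.
Variables (R : realType) (G : finZmodType).
Implicit Types (mu gamma : {ffun G -> R[i]}).

Definition is_character gamma : Prop :=
  (forall x, modulus (gamma x) = 1) /\ {morph gamma : x y / x + y >-> x * y}.

Definition dual_group : set {ffun G -> R[i]} := [set gamma | is_character gamma].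

Definition measure_norm (mu : cmeasure R G) : R := \sum_(x : G) modulus (mu x).

Definition fourier (mu : cmeasure R G) gamma : R[i] :=
  \sum_(x : G) (gamma x)^*%C * mu x.

(* A maximum, since the dual group is finite: see [fourier_norm_max]. *)
Definition fourier_norm (mu : cmeasure R G) : R :=
  sup [set modulus (fourier mu gamma) | gamma in dual_group].

Definition measure_supp (mu : cmeasure R G) : {set G} :=
  [set x | mu x != 0]%SET.

Definition extreme_measure (mu : cmeasure R G) : Prop :=
  mu != [ffun=> 0] /\
  fourier_norm mu = measure_norm mu / Num.sqrt #|measure_supp mu|%:R.

Definition extreme_set (E : {set G}) : Prop :=
  exists mu : cmeasure R G, extreme_measure mu /\ measure_supp mu = E.

Lemma character_unity gamma x : is_character gamma -> gamma x ^+ #|G| = 1.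
Proof.
move=> [g1 gD].
have g_neq0 y : gamma y != 0.
  apply/eqP => g0; have := g1 y; rewrite g0 ComplexField.Normc.normc0.
  by move/eqP; rewrite eq_sym oner_eq0.
have prod_neq0 : \prod_(y : G) gamma y != 0 by apply/prodf_neq0.
apply: (mulIf prod_neq0); rewrite mul1r.
rewrite [RHS](reindex_inj (addrI x)) /=.
under [RHS]eq_bigr => y _ do rewrite gD.
by rewrite big_split /= prodr_const.
Qed.

Lemma finite_dual_group : finite_set dual_group.
Proof.
pose p : {poly R[i]} := 'X^#|G| - 1.
have G0 : (0 < #|G|)%N by apply/card_gt0P; exists 0.
have p1 : p \is monic by exact: monicXnsubC.
have [r pr] := closed_field_poly_normal p.
rewrite (monicP p1) scale1r in pr.
have gr gamma x : is_character gamma -> gamma x \in r.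
  move=> gch; rewrite -root_prod_XsubC -pr rootE !hornerE.
  by rewrite character_unity ?subrr.
pose f (h : {ffun G -> seq_sub r}) : {ffun G -> R[i]} := [ffun x => val (h x)].
apply: (@sub_finite_set _ _ (f @` setT)); last first.
  by apply: finite_image; exact: finite_finset.
move=> gamma gch; exists [ffun x => SeqSub (gr gamma x gch)] => //.
by apply/ffunP => x; rewrite !ffunE.
Qed.

Lemma fourier_norm_max mu :
  (exists2 gamma, dual_group gamma &
     fourier_norm mu = modulus (fourier mu gamma)) /\
  (forall gamma, dual_group gamma ->
     modulus (fourier mu gamma) <= fourier_norm mu).
Proof.
set S := [set modulus (fourier mu gamma) | gamma in dual_group].
have Sfin : finite_set S by exact/finite_image/finite_dual_group.
have triv : dual_group [ffun=> 1].
  split=> [x|x y]; first by rewrite ffunE ComplexField.Normc.normc1.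
  by rewrite !ffunE mulr1.
have maxseq (s : seq R) : s != [::] ->
    exists2 m, m \in s & {in s, forall y, y <= m}.
  elim: s => // a [|b s] IHs _.
    by exists a; rewrite ?mem_head // => y; rewrite inE => /eqP ->.
  have [//|m ms mub] := IHs; have [am|ma] := leP a m.
    exists m; first by rewrite inE ms orbT.
    by move=> y; rewrite inE => /orP[/eqP -> //|/mub].
  exists a; first exact: mem_head.
  move=> y; rewrite inE => /orP[/eqP -> //|/mub ym].
  exact: le_trans ym (ltW ma).
have [s Ss] : exists s : seq R, S = [set` s] by apply/finite_seqP.
have [|m ms mub] := maxseq s.
  apply/eqP => s0; have : S (modulus (fourier mu [ffun=> 1])) by exists [ffun=> 1].
  by rewrite Ss s0.
have Sm : S m by rewrite Ss.
have Sub : ubound S m by move=> y; rewrite Ss; exact: mub.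
have supm : fourier_norm mu = m.
  apply/le_anti/andP; split; first by apply: ge_sup => //; exists m.
  by apply: ub_le_sup => //; exists m.
split; last by move=> gamma gch; rewrite supm; apply: Sub; exists gamma.
by case: Sm => gamma gch gm; exists gamma => //; rewrite supm -gm.
Qed.

End FiniteAbelianGroup.

Arguments extreme_set R {G} E.

(* Main.v *)
Require Import Defs.
From mathcomp Require Import all_boot all_order all_algebra complex reals.
From mathcomp Require Import ring.

(** Suppose that [mu] is unimodular on its support, of size [n], and that its
autocorrelation [d |-> \sum_x mu (x + d) * (mu x)^*] vanishes off [0].  The
function [|fourier mu|^2] is the Fourier transform of the autocorrelation
([fourier_mul_conjc]), hence is constant, equal to [n].  As the total mass of
[mu] is [n] too and [sqrt n = n / sqrt n], the measure [mu] is extreme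
([extreme_set_autocorrelation]).

It remains to find unimodular values [a_0, a_1, a_2, a_3, a_4, a_7] with
autocorrelation zero modulo 10.  Normalise [a_0 = 1] and put [v = a_1].
- Shift 2 gives three unimodular numbers of sum zero; they are proportional to
  the cube roots of unity, so that [a_2 = u], [a_3 = w u v] and
  [a_4 = w^2 u^2] with [w] a primitive cube root of unity.
- Shift 1 then gives [u = - v^2].
- Shift 5 says that [a_7 = t v^2] with [t = i] or [t = - i].
- Shifts 3 and 4 both reduce to [v^5 = - t w^2].

The choice [t = i], [v = - i w] solves the last equation and yields the values
[1, - i w, w^2, - i w, 1, - i w^2].  Their autocorrelation is a polynomial in
[i] and [w] that vanishes modulo [i^2 + 1] and [w^2 + w + 1], which is checked
for each shift ([twelfth_roots_autocorrelation]). *)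

Set Implicit Arguments.
Unset Strict Implicit.
Unset Printing Implicit Defensive.

Import Order.TTheory GRing.Theory Num.Theory.

Local Open Scope ring_scope.
Local Open Scope complex_scope.

Lemma mul_conjc_modulus (R : rcfType) (z : R[i]) :
  z * z^*%C = (modulus z ^+ 2)%:C.
Proof.
case: z => a b /=; rewrite sqr_sqrtr ?addr_ge0 ?sqr_ge0 //.
by simpc; congr (_ +i* _); ring.
Qed.

Lemma modulus_ge0 (R : rcfType) (z : R[i]) : 0 <= modulus z.
Proof. by case: z => a b; exact: sqrtr_ge0. Qed.

Section FlatSpectrum.
Variables (R : realType) (G : finZmodType).

Definition autocorrelation (mu : cmeasure R G) (d : G) : R[i] :=
  \sum_x mu (x + d) * (mu x)^*%C.

(** Grouping the pairs [(x, y)] of the double sum [|fourier mu gamma|^2] by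
their difference [x - y] leaves the autocorrelation at that difference. *)
Lemma fourier_mul_conjc (mu : cmeasure R G) gamma : is_character gamma ->
  fourier mu gamma * (fourier mu gamma)^*%C =
  \sum_d (gamma d)^*%C * autocorrelation mu d.
Proof.
move=> [gamma1 gammaD].
rewrite /fourier rmorph_sum mulr_sumr.
under [RHS]eq_bigr => d _ do rewrite mulr_sumr.
rewrite [RHS]exchange_big; apply: eq_bigr => y _ /=.
rewrite mulr_suml (reindex_inj (addrI y)) /=; apply: eq_bigr => d _.
have gg : (gamma y)^*%C * gamma y = 1.
  by rewrite mulrC mul_conjc_modulus gamma1 expr1n.
rewrite gammaD !rmorphM /= conjcK.
transitivity
    ((gamma y)^*%C * gamma y * ((gamma d)^*%C * (mu (y + d) * (mu y)^*%C))).
  by ring.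
by rewrite gg mul1r.
Qed.

(** The right-hand side of the hypothesis on [mu x * (mu x)^*] says both that
the support is [E] and that [mu] is unimodular there.  Only the shift [0] then
contributes to [fourier_mul_conjc], whatever the character. *)
Lemma extreme_set_autocorrelation (E : {set G}) (mu : cmeasure R G) :
  E != set0 ->
  (forall x, mu x * (mu x)^*%C = (x \in E)%:R) ->
  (forall d, d != 0 -> autocorrelation mu d = 0) ->
  extreme_set R E.
Proof.
move=> E_neq0 muE mu_auto.
have modulusE x : modulus (mu x) = (x \in E)%:R.
  apply: (@pexpIrn _ 2); rewrite ?nnegrE ?modulus_ge0 ?ler0n //.
  apply: (@complexI R); rewrite -mul_conjc_modulus muE.
  by case: (x \in E); rewrite ?expr1n ?expr0n.
have suppE : measure_supp mu = E.
  apply/setP => x; rewrite inE.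
  have := modulusE x; case: (x \in E) => [mu1|/ComplexField.Normc.eq0_normc ->].
    apply/eqP => mux0; move: mu1; rewrite mux0 ComplexField.Normc.normc0.
    by move/esym/eqP; rewrite oner_eq0.
  by rewrite eqxx.
exists mu; split=> //; rewrite /extreme_measure suppE; split.
  apply: contraNneq E_neq0 => mu0.
  by rewrite -suppE mu0; apply/eqP/setP => x; rewrite !inE ffunE eqxx.
set n : R := #|E|%:R.
have sum_E (V : pzSemiRingType) : \sum_x (x \in E)%:R = #|E|%:R :> V.
  rewrite -sum1_card natr_sum [RHS]big_mkcond; apply: eq_bigr => x _.
  by case: (x \in E).
have -> : measure_norm mu = n.
  by rewrite /n -sum_E; apply: eq_bigr => x _; rewrite modulusE.
have [[gamma gamma_char ->] _] := fourier_norm_max mu.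
have sqr_fourier : modulus (fourier mu gamma) ^+ 2 = n.
  apply: (@complexI R); rewrite -mul_conjc_modulus fourier_mul_conjc //.
  rewrite (bigD1 0) //= big1 ?addr0; last by move=> d /mu_auto ->; rewrite mulr0.
  have gamma0 : gamma 0 = 1.
    have [gamma1 gammaD] := gamma_char.
    apply: (@mulfI _ (gamma 0)); last by rewrite -gammaD addr0 mulr1.
    apply/eqP => g0; have := gamma1 0.
    by rewrite g0 ComplexField.Normc.normc0 => /esym/eqP; rewrite oner_eq0.
  rewrite gamma0 conjc1 mul1r /n rmorph_nat -sum_E.
  by apply: eq_bigr => x _; rewrite addr0 muE.
have n_gt0 : 0 < n by rewrite ltr0n card_gt0.
have sqrt_neq0 : Num.sqrt n != 0 by rewrite sqrtr_eq0 -ltNge.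
rewrite -[LHS](ger0_norm (modulus_ge0 _)) -sqrtr_sqr sqr_fourier.
by apply: (mulIf sqrt_neq0); rewrite divfK // -expr2 sqr_sqrtr // ltW.
Qed.

End FlatSpectrum.

Definition cube_root1 (R : rcfType) : R[i] :=
  (- 2^-1) +i* (Num.sqrt 3 / 2).

Lemma sqr_cube_root1 (R : rcfType) :
  cube_root1 R ^+ 2 = - 1 - cube_root1 R.
Proof.
have sqrt3 : Num.sqrt (3 : R) ^+ 2 = 3 by rewrite sqr_sqrtr ?ler0n.
rewrite /cube_root1 expr2; simpc; congr (_ +i* _); last by field.
by field: sqrt3.
Qed.

Lemma conjc_cube_root1 (R : rcfType) :
  (cube_root1 R)^*%C = - 1 - cube_root1 R.
Proof. by rewrite /cube_root1; simpc; congr (_ +i* _); field. Qed.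

Lemma conjc_i (R : rcfType) : ('i%C : R[i])^*%C = - 'i%C.
Proof. by simpc. Qed.

(** The values are built from abstract [i] and [w] with the relations below: the
concrete complex numbers would be expanded into real and imaginary parts by
simplification, which destroys the polynomial identities in [i] and [w]. *)
Section TwelfthRoots.
Variables (R : realType) (i w : R[i]).
Hypotheses (sqr_i : i ^+ 2 = - 1) (conj_i : i^*%C = - i).
Hypotheses (sqr_w : w ^+ 2 = - 1 - w) (conj_w : w^*%C = - 1 - w).

(* Keeps [1^*] folded when [/=] evaluates the entries of the list below. *)
#[local] Arguments conjc : simpl never.

Definition twelfth_roots : cmeasure R 'Z_10 :=
  [ffun x : 'Z_10 =>
    [:: 1; - (i * w); w ^+ 2; - (i * w); 1; 0; 0; - (i * w ^+ 2); 0; 0]`_x].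

Lemma twelfth_roots_mul_conjc (x : 'Z_10) :
  twelfth_roots x * (twelfth_roots x)^*%C =
  (x \in ([set 0; 1; 2; 3; 4; 7] : {set 'Z_10}))%:R.
Proof.
rewrite ffunE !inE; case: x => [[|[|[|[|[|[|[|[|[|[|m]]]]]]]]]] lt_x10] //=.
all: rewrite ?(conjc0, conjc1, rmorphN, rmorphM, rmorphXn) /= ?conj_i ?conj_w.
all: by ring: sqr_i sqr_w.
Qed.

Lemma twelfth_roots_autocorrelation (d : 'Z_10) :
  d != 0 -> autocorrelation twelfth_roots d = 0.
Proof.
rewrite /autocorrelation; case: d => [[|[|[|[|[|[|[|[|[|[|m]]]]]]]]]] lt_d10] //= _.
all: rewrite !big_ord_recl big_ord0 !ffunE /=.
all: rewrite ?(conjc0, conjc1, rmorphN, rmorphM, rmorphXn) /= ?conj_i ?conj_w.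
all: by ring: sqr_i sqr_w.
Qed.

End TwelfthRoots.

Theorem proposition7p10 (R : realType) :
  extreme_set R ([set 0; 1; 2; 3; 4; 7] : {set 'Z_10}).
Proof.
have i2 := sqr_i R; have iJ := conjc_i R.
have w2 := sqr_cube_root1 R; have wJ := conjc_cube_root1 R.
apply: (@extreme_set_autocorrelation _ _ _ (twelfth_roots 'i%C (cube_root1 R))).
- by apply/set0Pn; exists 0; rewrite !inE.
- exact: twelfth_roots_mul_conjc.
- exact: twelfth_roots_autocorrelation.
Qed.
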